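(* For every $n \in \mathbb{N}$ and every integer $j$ with $\max(1,\lfloor n/2 \rfloor) \le j \le n$, $d_w(P_n, j) = \binom{j+1}{n-j}$.
   Context: All graphs are finite and simple. For a connected graph $H$, a non-empty set $S \subseteq V(H)$ is a weakly connected dominating set of $H$ if the spanning subgraph of $H$ obtained by removing all edges joining two vertices of $V(H)\setminus S$ is connected. $d_w(H,j)$ is the number of weakly connected dominating sets of $H$ of cardinality $j$. $P_n$ is the path on $n$ vertices. Binomial coefficients $\binom{a}{b}$ with $b>a$ are $0$. *)

(* Defs.v *)
From mathcomp Require Import all_boot.

Set Implicit Arguments.
Unset Strict Implicit.
Unset Printing Implicit Defensive.

Record sgraph := SGraph {
  vertex :> finType;
  adj : rel vertex;
  adj_sym : symmetric adj;
  adj_irr : irreflexive adj }.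

(* The vertexless graph counts as connected here; this does not affect
   [wcds], which also requires S to be non-empty. *)
Definition connected (G : sgraph) : bool :=
  [forall x : G, forall y : G, connect (@adj G) x y].

Section WeaklyConnectedDomination.

Variable G : sgraph.

Definition weak_adj (S : {set G}) : rel G :=
  [rel x y | adj x y && ~~ ((x \in ~: S) && (y \in ~: S))].

Fact weak_adj_sym S : symmetric (weak_adj S).
Proof. by move=> x y; rewrite /weak_adj /= adj_sym [(y \in _) && _]andbC. Qed.

Fact weak_adj_irr S : irreflexive (weak_adj S).
Proof. by move=> x; rewrite /weak_adj /= adj_irr. Qed.

Definition weak_subgraph (S : {set G}) : sgraph :=
  SGraph (weak_adj_sym S) (weak_adj_irr S).

Definition wcds (S : {set G}) : bool :=
  (S != set0) && connected (weak_subgraph S).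

Definition d_w (j : nat) : nat := #|[set S : {set G} | wcds S & #|S| == j]|.

End WeaklyConnectedDomination.

Definition path_adj (n : nat) : rel 'I_n :=
  [rel x y : 'I_n | (x.+1 == y :> nat) || (y.+1 == x :> nat)].

Fact path_adj_sym n : symmetric (@path_adj n).
Proof. by move=> x y; rewrite /path_adj /= orbC. Qed.

Fact path_adj_irr n : irreflexive (@path_adj n).
Proof. by move=> x; rewrite /path_adj /= orbb gtn_eqF. Qed.

Definition path_graph (n : nat) : sgraph :=
  SGraph (@path_adj_sym n) (@path_adj_irr n).

Fact path_graph_connected n : connected (path_graph n).
Proof.
have up k (x y : 'I_n) : y = x + k :> nat -> connect (@path_adj n) x y.
  elim: k y => [|k IHk] y.
    by rewrite addn0 => /val_inj->; exact: connect0.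
  rewrite addnS => yE.
  have ltk : x + k < n by rewrite (leq_trans _ (ltn_ord y)) // yE ltnS leqnSn.
  apply: connect_trans (IHk (Ordinal ltk) erefl) (connect1 _).
  by rewrite /path_adj /= yE eqxx.
have csym := @sym_connect_sym _ (@path_adj n) (@path_adj_sym n).
apply/forallP=> x; apply/forallP=> y /=.
case/orP: (leq_total x y) => le_xy; last rewrite csym.
  by apply: (up (y - x)); rewrite subnKC.
by apply: (up (x - y)); rewrite subnKC.
Qed.

(* Main.v *)
(** Two consecutive vertices of a path are joined by one edge only, a bridge.
    Hence a non-empty set S is weakly connected dominating exactly when it
    misses no two consecutive vertices.  Bit strings of length n with j ones
    and no two consecutive zeros start with 1 or with 01, so that they are
    counted by the Pascal recurrence. *)
Require Import Defs.
From mathcomp Require Import all_boot.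
From mathcomp Require Import zify.

Set Implicit Arguments.
Unset Strict Implicit.
Unset Printing Implicit Defensive.

(** An explicit list, built by the leading bit, lets [count] follow the Pascal recurrence by
    computation. *)
Fixpoint bitseqs (n : nat) : seq bitseq :=
  if n is m.+1 then map (cons true) (bitseqs m) ++ map (cons false) (bitseqs m)
  else [:: [::]].

Lemma mem_bitseqs n s : (s \in bitseqs n) = (size s == n).
Proof.
have inj (b : bool) : injective (cons b) by move=> x y [].
elim: n s => [|n IHn] [|b s] //=; rewrite mem_cat.
  by apply/negbTE; rewrite negb_or; apply/andP; split; apply/mapP => -[].
rewrite eqSS -IHn; case: b; rewrite (mem_map (@inj _)).
  by apply/orb_idr => /mapP[].
by apply/orb_idl => /mapP[].
Qed.

Lemma bitseqs_uniq n : uniq (bitseqs n).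
Proof.
elim: n => //= n IHn; rewrite cat_uniq !map_inj_uniq ?IHn; try by move=> x y [].
by rewrite andbT; apply/hasPn => _ /mapP[s _ ->]; apply/mapP => -[].
Qed.

(** [orb] is not an order: [sorted] serves only to test every pair of consecutive bits, each of
    which must contain a one. *)
Definition no_adjacent_false (j : nat) (s : bitseq) : bool :=
  sorted orb s && (count id s == j).

Lemma path_orb_true s : path orb true s = sorted orb s.
Proof. by case: s. Qed.

(** Without ones a string is all zeros, so two zeros are adjacent as soon as its length reaches
    2. *)
Lemma count_no_adjacent_false0 n :
  count (no_adjacent_false 0) (bitseqs n) = (n < 2).
Proof.
case: n => [|[|n]] //=; rewrite !count_cat !map_cat !count_cat !count_map.
by rewrite !(@eq_count _ _ pred0) ?count_pred0 // => s;
  rewrite /no_adjacent_false /= ?andbF.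
Qed.

Lemma count_no_adjacent_falseSS n j :
  count (no_adjacent_false j.+1) (bitseqs n.+2) =
  count (no_adjacent_false j) (bitseqs n.+1)
  + count (no_adjacent_false j) (bitseqs n).
Proof.
rewrite [bitseqs n.+2]/= -/(bitseqs n.+1) count_cat !count_map; congr (_ + _).
  by apply: eq_count => s; rewrite /no_adjacent_false /= path_orb_true.
rewrite [bitseqs n.+1]/= count_cat !count_map -[RHS]addn0; congr (_ + _).
  by apply: eq_count => s; rewrite /no_adjacent_false /= path_orb_true.
(* Strings starting with 00 are all rejected; they account for the added 0. *)
by rewrite (@eq_count _ _ pred0) ?count_pred0.
Qed.

(** The recurrence lowers the length by one and by two, hence the strong induction. The bound
    [j <= n] keeps the truncated [n - j] meaningful: beyond it the binomial would be 1 and the count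
    0. *)
Lemma count_no_adjacent_false n j :
  j <= n -> count (no_adjacent_false j) (bitseqs n) = 'C(j.+1, n - j).
Proof.
elim/ltn_ind: n j => n IHn [|j] le_jn.
  by rewrite count_no_adjacent_false0 subn0; case: n {IHn le_jn} => [|[]].
case: n IHn le_jn => [|[|n]] // IHn; first by case: j.
rewrite count_no_adjacent_falseSS ltnS => le_jn.
rewrite IHn // subSS; case: (ltngtP j n.+1) le_jn => // [lt_jn|->] _.
  by rewrite IHn // subSn // binS.
(* All bits are ones here. The induction hypothesis does not cover the second summand, which
   vanishes because a string of length [n] cannot hold [n.+1] ones. *)
rewrite subnn !bin0 -[RHS]addn0; congr (_ + _); apply/eqP.
rewrite -leqn0 leqNgt -has_count; apply/hasPn => s.
rewrite mem_bitseqs => /eqP ss; rewrite negb_and; apply/orP; right.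
by rewrite ltn_eqF // ltnS -ss count_size.
Qed.

Lemma connected_weak_path n (S : {set path_graph n}) :
  reflect (forall x y : 'I_n, y = x.+1 :> nat -> (x \in S) || (y \in S))
          (connected (weak_subgraph S)).
Proof.
have csym := @sym_connect_sym _ (@weak_adj (path_graph n) S)
               (@weak_adj_sym (path_graph n) S).
apply: (iffP idP) => [conn x y yE | dom].
  apply: contraT; rewrite negb_or => /andP[xNS yNS].
  (* The only path edge leaving this initial segment is the one from [x] to [y], and it is removed
     when both ends lie outside [S]. *)
  have cl : closed (@weak_adj (path_graph n) S) [pred z : 'I_n | z <= x].
    apply: intro_closed => // u v /andP[/= uv].
    rewrite !inE => uvS le_ux; rewrite leqNgt; apply/negP => lt_xv.
    have [ux vy] : u = x /\ v = y.
      by split; apply: val_inj => /=; case/orP: uv => /eqP; lia.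
    by rewrite ux vy xNS yNS in uvS.
  have /= := closed_connect cl (forallP (forallP conn x) y).
  by rewrite !inE leqnn yE ltnn.
(* Conversely, [dom] preserves every edge of the path, so one can walk upwards in [k] steps. *)
have up k (x y : 'I_n) :
    y = x + k :> nat -> connect (@weak_adj (path_graph n) S) x y.
  elim: k y => [|k IHk] y.
    by rewrite addn0 => /val_inj->; exact: connect0.
  rewrite addnS => yE.
  have ltk : x + k < n by rewrite (leq_trans _ (ltn_ord y)) // yE ltnS leqnSn.
  apply: connect_trans (IHk (Ordinal ltk) erefl) (connect1 _).
  by rewrite /weak_adj /= /path_adj /= yE eqxx /= !inE -negb_or negbK dom.
apply/forallP=> x; apply/forallP=> y /=.
case/orP: (leq_total x y) => le_xy; last rewrite csym.
  by apply: (up (y - x)); rewrite subnKC.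
by apply: (up (x - y)); rewrite subnKC.
Qed.

Definition bits n (S : {set 'I_n}) : bitseq := [seq i \in S | i <- enum 'I_n].

Lemma size_bits n (S : {set 'I_n}) : size (bits S) = n.
Proof. by rewrite size_map size_enum_ord. Qed.

Lemma nth_bits n (S : {set 'I_n}) (i : 'I_n) : nth false (bits S) i = (i \in S).
Proof. by rewrite (nth_map i) ?size_enum_ord // nth_ord_enum. Qed.

Lemma bits_inj n : injective (@bits n).
Proof. by move=> S T eqST; apply/setP => i; rewrite -!nth_bits eqST. Qed.

Lemma count_bits n (S : {set 'I_n}) : count id (bits S) = #|S|.
Proof. by rewrite count_map cardE -size_filter enumT. Qed.

Lemma sorted_bits n (S : {set path_graph n}) :
  sorted orb (bits S) = connected (weak_subgraph S).
Proof.
apply/(sortedP false)/connected_weak_path => [srt x y yE | dom i].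
  by rewrite -!nth_bits yE srt // size_bits -yE.
rewrite size_bits => lt_i1n; have lt_in := ltnW lt_i1n.
rewrite (nth_bits S (Ordinal lt_in)) (nth_bits S (Ordinal lt_i1n)).
exact: dom.
Qed.

(** Characteristic vectors map the counted sets bijectively onto the admissible strings, so the two
    duplicate-free lists are permutations of each other. *)
Lemma d_w_path n j :
  0 < j -> d_w (path_graph n) j = count (no_adjacent_false j) (bitseqs n).
Proof.
move=> j_gt0; rewrite /d_w cardE -(size_map (@bits n)) -size_filter.
apply/perm_size/uniq_perm.
- by rewrite map_inj_uniq ?enum_uniq //; apply: bits_inj.
- by rewrite filter_uniq ?bitseqs_uniq.
move=> s; rewrite mem_filter mem_bitseqs; apply/mapP/andP => [[S] | [sP /eqP sz]].
  rewrite mem_enum inE => /andP[/andP[_ conn] cardS] ->.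
  by rewrite size_bits /no_adjacent_false sorted_bits conn count_bits cardS.
pose S : {set path_graph n} := [set i : 'I_n | nth false s i].
have sE : s = bits S.
  apply: (@eq_from_nth _ false) => [|i]; rewrite ?size_bits // sz => lt_in.
  by rewrite (nth_bits S (Ordinal lt_in)) inE.
exists S => //; move: sP; rewrite sE /no_adjacent_false sorted_bits count_bits.
rewrite mem_enum inE /wcds => /andP[-> cardS]; rewrite cardS !andbT.
(* Non-emptiness of [S] comes from [0 < j]. *)
by rewrite -card_gt0 (eqP cardS).
Qed.

Theorem theorem3p8 (n j : nat) (hj : maxn 1 (n %/ 2) <= j <= n) :
  d_w (path_graph n) j = 'C(j + 1, n - j).
Proof.
have /andP[] := hj; rewrite geq_max => /andP[j_gt0 _] le_jn.
by rewrite d_w_path // count_no_adjacent_false // addn1.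
Qed.
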